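(* Let $\{(\mathcal{W}_i,v_i)\}_{i\in I}$ be a fusion frame for a Hilbert space $\mathcal{H}$ with optimal fusion frame bounds $0<A\le B<\infty$. Then the following conditions are equivalent. (i) $\bigcap_{i\in I}\mathcal{W}_i=\{0\}$. (ii) $B<\sum_{i\in I}v_i^2$. (iii) The family $\{(\mathcal{W}_i^\perp,v_i)\}_{i\in I}$ is a fusion frame for $\mathcal{H}$ with optimal fusion frame bounds $\sum_{i\in I}v_i^2-B$ and $\sum_{i\in I}v_i^2-A$.
   Context: For a Hilbert space $\mathcal{H}$, a family of closed subspaces $\{\mathcal{W}_i\}_{i\in I}$ with positive weights $v_i$ is a fusion frame for $\mathcal{H}$, written $\{(\mathcal{W}_i,v_i)\}_{i\in I}$, if there are constants $0<A\le B<\infty$ (fusion frame bounds) with $A\|f\|^2\le\sum_{i\in I}v_i^2\|P_if\|^2\le B\|f\|^2$ for all $f\in\mathcal{H}$, where $P_i$ is the orthogonal projection onto $\mathcal{W}_i$. The bounds are optimal if $A$ is the largest and $B$ the smallest such constant. $\mathcal{W}_i^\perp$ is the orthogonal complement of $\mathcal{W}_i$ in $\mathcal{H}$.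
   Formalization: As stated the equivalence is false: (i)⇒(ii) can fail in infinite dimension, and (ii)⇒(iii) when the sum of v_i^2 is infinite. Proved: (i)⇔(ii) for finite-dimensional H; (ii)⇔(iii) when the sum of v_i^2 is finite; (ii)⇒(i) and (iii)⇒(ii) always. *)

(* Defs.v *)
From HB Require Import structures.
From mathcomp Require Import all_boot all_order all_algebra.
From mathcomp Require Import complex.
From mathcomp Require Import all_classical all_reals all_analysis.

Set Implicit Arguments.
Unset Strict Implicit.
Unset Printing Implicit Defensive.

Import Order.TTheory GRing.Theory Num.Theory.
Import numFieldNormedType.Exports.

Local Open Scope classical_set_scope.
Local Open Scope ring_scope.

(* Real and complex Hilbert spaces are treated together. *)
Inductive scalar_kind := RealScalars | ComplexScalars.

Definition scalar_field (R : realType) (k : scalar_kind) : numFieldType :=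
  match k with RealScalars => R | ComplexScalars => R[i] end.

Definition scalar_conj (R : realType) (k : scalar_kind) :
    scalar_field R k -> scalar_field R k :=
  match k with RealScalars => fun x : R => x
             | ComplexScalars => fun z : R[i] => conjc z end.

Definition scalar_re (R : realType) (k : scalar_kind) : scalar_field R k -> R :=
  match k with RealScalars => fun x : R => x
             | ComplexScalars => fun z : R[i] => complex.Re z end.

Section HilbertSpace.
Variables (R : realType) (k : scalar_kind).
Variable H : completeNormedModType (scalar_field R k).

(* The norm of H takes its values in scalar_field R k; this is the same number,
   as an element of R. *)
Definition hnorm (x : H) : R := scalar_re `|x|.

Definition finite_dimensional : Prop :=
  exists (n : nat) (e : 'I_n -> H),
    forall x : H, exists c : 'I_n -> scalar_field R k, x = \sum_i c i *: e i.

Definition closed_subspace (W : set H) : Prop :=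
  [/\ W 0, (forall (a : scalar_field R k) (x y : H), W x -> W y -> W (a *: x + y))
    & closed W].

(* Linear in the first argument, conjugate-linear in the second, and positive
   definite. *)
Variable ip : {dot H for @scalar_conj R k}.

(* With completeness of H, this makes (H, ip) a Hilbert space. *)
Definition norm_from_ip : Prop := forall x : H, `|x| ^+ 2 = ip x x.

Definition orth_compl (W : set H) : set H :=
  [set x | forall y, W y -> ip x y = 0].

(* The point p of W such that f - p is orthogonal to W; it exists and is unique
   when W is a closed subspace. The value 0 is a default otherwise. *)
Definition orth_proj (W : set H) (f : H) : H :=
  xget 0 [set p | W p /\ orth_compl W (f - p)].

Variable I : choiceType.
Implicit Types (W : I -> set H) (v : I -> R).

Definition total_weight v : \bar R := (\esum_(i in [set: I]) (v i ^+ 2)%:E)%E.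

(* The bounds are extended reals so that expressions such as
   total_weight v - B, which may be infinite, can be claimed as bounds;
   genuine bounds are finite. *)
Definition fusion_frame W v (A B : \bar R) : Prop :=
  [/\ forall i, closed_subspace (W i),
      forall i, 0 < v i,
      [/\ (0 < A)%E, (A <= B)%E & (B < +oo)%E]
    & forall f : H,
        let s := (\esum_(i in [set: I])
                    (v i ^+ 2 * hnorm (orth_proj (W i) f) ^+ 2)%:E)%E in
        (A * (hnorm f ^+ 2)%:E <= s)%E /\ (s <= B * (hnorm f ^+ 2)%:E)%E].

Definition optimal_fusion_frame W v (A B : \bar R) : Prop :=
  fusion_frame W v A B /\
  forall A' B' : \bar R, fusion_frame W v A' B' -> (A' <= A)%E /\ (B <= B')%E.

End HilbertSpace.

(* Main.v *)
Require Import Defs.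
From HB Require Import structures.
From mathcomp Require Import all_boot all_order all_algebra.
From mathcomp Require Import complex.
From mathcomp Require Import all_classical all_reals all_analysis.
From mathcomp Require Import ring lra.
Import Order.TTheory GRing.Theory Num.Theory.
Import numFieldNormedType.Exports.
Local Open Scope classical_set_scope.
Local Open Scope ring_scope.

Set Implicit Arguments.
Unset Strict Implicit.
Unset Printing Implicit Defensive.

(* Write t for the sum of the v_i^2 and S f for the frame sum of the W_i at f.
   Since |P_i f|^2 + |f - P_i f|^2 = |f|^2, the frame sum of the complements is
   t |f|^2 - S f, which exchanges lower and upper bounds and gives
   (ii) <-> (iii) when t is finite. A nonzero f in every W_i has
   S f = t |f|^2, so B < t forces the intersection to be trivial. Conversely,
   in finite dimension already finitely many W_i have trivial intersection, so
   the form sum v_i^2 <f - P_i f, g - P_i g> over these i is positive definite;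
   by Gram-Schmidt it dominates a positive multiple c of |f|^2, and then t - c
   is an upper frame bound. *)

(** * Real numbers as scalars of either kind *)

Definition scalar_of (R : realType) (k : scalar_kind) (x : R) :
    scalar_field R k :=
  match k with RealScalars => x | ComplexScalars => real_complex R x end.

Section Scalars.
Variables (R : realType) (k : scalar_kind).
Implicit Types (x y : R) (z w : scalar_field R k).

Lemma scalar_ofD x y : scalar_of k (x + y) = scalar_of k x + scalar_of k y.
Proof. by case: k => //=; rewrite rmorphD. Qed.

Lemma scalar_ofM x y : scalar_of k (x * y) = scalar_of k x * scalar_of k y.
Proof. by case: k => //=; rewrite rmorphM. Qed.

Lemma scalar_of1 : scalar_of k (1 : R) = 1.
Proof. by case: k. Qed.

Lemma scalar_of0 : scalar_of k (0 : R) = 0.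
Proof. by case: k. Qed.

Lemma le_scalar_of x y : (scalar_of k x <= scalar_of k y) = (x <= y).
Proof. by case: k => //=; rewrite lecR. Qed.

Lemma lt_scalar_of x y : (scalar_of k x < scalar_of k y) = (x < y).
Proof. by case: k => //=; rewrite ltcR. Qed.

Lemma scalar_ofK x : scalar_re (scalar_of k x) = x.
Proof. by case: k. Qed.

(** The order on [R[i]] relates only numbers with equal imaginary parts, so a nonnegative scalar is
    real. *)
Lemma ge0_scalar_reK z : 0 <= z -> scalar_of k (scalar_re z) = z.
Proof.
case: k z => //= -[a b]; rewrite lecE /= => /andP[/eqP b0 _].
by rewrite b0.
Qed.

Lemma scalar_reD z w : scalar_re (z + w) = scalar_re z + scalar_re w.
Proof. by case: k z w => //= -[a b] [c d]. Qed.

Lemma scalar_reN z : scalar_re (- z) = - scalar_re z.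
Proof. by case: k z => //= -[a b]. Qed.

Lemma scalar_reZ x z : scalar_re (scalar_of k x * z) = x * scalar_re z.
Proof. by case: k z => //= -[a b] /=; rewrite mul0r subr0. Qed.

Lemma scalar_conjD z w : scalar_conj (z + w) = scalar_conj z + scalar_conj w.
Proof. by case: k z w => //= z w; rewrite rmorphD. Qed.

Lemma scalar_conjM z w : scalar_conj (z * w) = scalar_conj z * scalar_conj w.
Proof. by case: k z w => //= z w; rewrite rmorphM. Qed.

Lemma scalar_conj0 : scalar_conj (0 : scalar_field R k) = 0.
Proof. by case: k => //=; rewrite oppr0. Qed.

Lemma scalar_conj_of x : scalar_conj (scalar_of k x) = scalar_of k x.
Proof. by case: k => //=; rewrite oppr0. Qed.

Lemma scalar_re_conj z : scalar_re (scalar_conj z) = scalar_re z.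
Proof. by case: k z => //= -[a b]. Qed.

Lemma mul_scalar_conj z : z * scalar_conj z = `|z| ^+ 2.
Proof.
case: k z => /= [z|[a b]]; first by rewrite real_normK ?num_real.
rewrite normc_def /= -rmorphXn /= sqr_sqrtr ?addr_ge0 ?sqr_ge0//.
by apply/eqP; rewrite eq_complex /=; apply/andP; split; apply/eqP; ring.
Qed.

End Scalars.

(** * Inner product, norm and orthogonal complements *)

Section InnerProduct.
Variables (R : realType) (k : scalar_kind).
Variable H : completeNormedModType (scalar_field R k).
Variable ip : {dot H for @scalar_conj R k}.
Hypothesis ipE : norm_from_ip ip.
Implicit Types (f g h x y : H) (W : set H).

Lemma ipDl x y h : ip (x + y) h = ip x h + ip y h.
Proof. exact: linearDl. Qed.

Lemma ipDr x y h : ip h (x + y) = ip h x + ip h y.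
Proof. exact: linearD. Qed.

Lemma ipNl x h : ip (- x) h = - ip x h.
Proof. exact: linearNl. Qed.

Lemma ipNr x h : ip h (- x) = - ip h x.
Proof. exact: linearN. Qed.

Lemma ipZl a x h : ip (a *: x) h = a * ip x h.
Proof. exact: linearZl_LR. Qed.

Lemma ipC x y : ip y x = scalar_conj (ip x y).
Proof.
by rewrite (@hermitian_subproof _ _ _ _ ip y x) expr0 mul1r.
Qed.

Lemma ip0l h : ip 0 h = 0.
Proof. exact: linear0l. Qed.

Lemma ip_eq0C x y : ip x y = 0 -> ip y x = 0.
Proof. by move=> xy; rewrite ipC xy scalar_conj0. Qed.

Lemma ipZr a x h : ip h (a *: x) = scalar_conj a * ip h x.
Proof. by rewrite ipC ipZl scalar_conjM -ipC. Qed.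

Lemma scalar_of_hnorm x : scalar_of k (hnorm x) = `|x|.
Proof. by rewrite /hnorm ge0_scalar_reK. Qed.

Lemma hnorm_ge0 x : 0 <= hnorm x.
Proof. by rewrite -(le_scalar_of k) scalar_of_hnorm scalar_of0. Qed.

Lemma hnorm0 : hnorm (0 : H) = 0.
Proof. by rewrite /hnorm normr0 -(scalar_of0 R k) scalar_ofK. Qed.

Lemma hnorm_eq0 x : hnorm x = 0 -> x = 0.
Proof.
by move=> x0; apply/eqP; rewrite -normr_eq0 -scalar_of_hnorm x0 scalar_of0.
Qed.

Lemma hnormN x : hnorm (- x) = hnorm x.
Proof. by rewrite /hnorm normrN. Qed.

Lemma ler_hnormD x y : hnorm (x + y) <= hnorm x + hnorm y.
Proof.
by rewrite -(le_scalar_of k) scalar_ofD !scalar_of_hnorm ler_normD.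
Qed.

Lemma hnormZ a x : hnorm (a *: x) = scalar_re `|a| * hnorm x.
Proof.
by rewrite [LHS]/hnorm normrZ -[in LHS](@ge0_scalar_reK _ _ `|a|)// scalar_reZ.
Qed.

Lemma ipxx x : ip x x = scalar_of k (hnorm x ^+ 2).
Proof. by rewrite expr2 scalar_ofM scalar_of_hnorm -expr2 ipE. Qed.

Lemma hnorm_sqrD x y : hnorm (x + y) ^+ 2 =
  hnorm x ^+ 2 + hnorm y ^+ 2 + 2 * scalar_re (ip x y).
Proof.
have hE u : hnorm u ^+ 2 = scalar_re (ip u u) by rewrite ipxx scalar_ofK.
rewrite !hE ipDl !ipDr !scalar_reD.
rewrite [ip y x]ipC scalar_re_conj; ring.
Qed.

Lemma hnorm_sqrB x y : hnorm (x - y) ^+ 2 =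
  hnorm x ^+ 2 + hnorm y ^+ 2 - 2 * scalar_re (ip x y).
Proof. by rewrite hnorm_sqrD hnormN ipNr scalar_reN; ring. Qed.

Lemma hnorm_pythagoras x y : ip x y = 0 ->
  hnorm (x + y) ^+ 2 = hnorm x ^+ 2 + hnorm y ^+ 2.
Proof.
move=> xy; rewrite hnorm_sqrD xy -(scalar_of0 R k) scalar_ofK.
by rewrite mulr0 addr0.
Qed.

Lemma closed_subspace_cvg W (u : nat -> H) x : closed W ->
  (forall n, W (u n)) ->
  (forall e : R, 0 < e -> exists n, hnorm (x - u n) < e) -> W x.
Proof.
move=> Wcl Wu xu; apply: Wcl => B /nbhs_normP [/= e e0 eB].
have := ge0_scalar_reK (ltW e0); move: (scalar_re e) => r er.
have r0 : 0 < r by rewrite -(lt_scalar_of k) scalar_of0 er.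
have [n un] := xu _ r0; exists (u n); split => //; apply: eB.
by rewrite /ball_ /= -er -scalar_of_hnorm lt_scalar_of.
Qed.

(** Cauchy-Schwarz for the real part: the triangle inequality comes with the norm of [H], and
    squaring it leaves this bound once the squares cancel. *)
Lemma scalar_re_ip_le x y : scalar_re (ip x y) <= hnorm x * hnorm y.
Proof.
have : hnorm (x + y) ^+ 2 <= (hnorm x + hnorm y) ^+ 2.
  by rewrite ler_sqr ?nnegrE ?addr_ge0 ?hnorm_ge0// ler_hnormD.
rewrite hnorm_sqrD sqrrD => {}; lra.
Qed.

(** Since [ip] is conjugate-linear on the right, the coefficient [ip x y] meets its own
    conjugate. *)
Lemma scalar_re_ipZ x y :
  scalar_re (ip x (ip x y *: y)) = scalar_re `|ip x y| ^+ 2.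
Proof.
rewrite ipZr mulrC mul_scalar_conj.
by rewrite -{1}[`|ip x y|]ge0_scalar_reK// expr2 scalar_reZ scalar_ofK.
Qed.

(* For complex scalars the real part alone loses information; testing it
   against every multiple of y recovers the whole inner product. *)
Lemma ip_eq0 x y : (forall a, scalar_re (ip x (a *: y)) <= 0) -> ip x y = 0.
Proof.
move=> /(_ (ip x y)); rewrite scalar_re_ipZ => xy.
have /eqP : scalar_re `|ip x y| ^+ 2 = 0.
  by apply/eqP; rewrite eq_le xy sqr_ge0.
rewrite sqrf_eq0 => /eqP xy0; apply/eqP; rewrite -normr_eq0.
by rewrite -[`|_|]ge0_scalar_reK// xy0 scalar_of0.
Qed.

(** For closedness, a point [x] of the closure is approximated by [z] in the complement; [ip x w]
    equals [ip (x - z) w], which Cauchy-Schwarz makes small. *)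
Lemma closed_orth_compl W : closed_subspace (orth_compl ip W).
Proof.
split=> [y _|a x y Wx Wy z Wz|]; first exact: ip0l.
  by rewrite ipDl ipZl Wx// Wy// mulr0 addr0.
move=> x clx y Wy; apply: ip_eq0 => a; apply/ler_addgt0Pl => e e0.
rewrite addr0; set w := a *: y.
(* The added 1 covers the case [w = 0] in the division below. *)
have w1 : 0 < hnorm w + 1 by rewrite ltr_wpDl ?hnorm_ge0.
have ew : 0 < e / (hnorm w + 1) by rewrite divr_gt0.
have ew' : 0 < scalar_of k (e / (hnorm w + 1)).
  by rewrite -(scalar_of0 R k) lt_scalar_of.
have [z [Wz]] := clx _ (nbhsx_ballx x _ ew').
rewrite -ball_normE /ball_ /= -scalar_of_hnorm lt_scalar_of => xz.
have -> : ip x w = ip (x - z) w.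
  by rewrite ipDl ipNl [ip z w]ipZr Wz// mulr0 oppr0 addr0.
apply: (le_trans (scalar_re_ip_le _ _)).
apply: (@le_trans _ _ (e / (hnorm w + 1) * hnorm w)).
  by rewrite ler_wpM2r ?hnorm_ge0// ltW.
rewrite mulrAC ler_pdivrMr// ler_wpM2l ?ltW// ?ltrDl//.
Qed.

Lemma hnorm_scalar_of t x : 0 <= t -> hnorm (scalar_of k t *: x) = t * hnorm x.
Proof.
move=> t0; rewrite hnormZ ger0_norm ?scalar_ofK//.
by rewrite -(scalar_of0 R k) le_scalar_of.
Qed.

(** * Orthogonal projection onto a closed subspace *)

Section Projection.
Variables (W : set H) (f : H).
Hypothesis Wsub : closed_subspace W.

Lemma closed_subspace_scale a x : W x -> W (a *: x).
Proof. by case: Wsub => W0 WL _ Wx; rewrite -[a *: x]addr0; exact: WL. Qed.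

Lemma closed_subspaceD x y : W x -> W y -> W (x + y).
Proof. by case: Wsub => W0 WL _ Wx Wy; rewrite -[x]scale1r; exact: WL. Qed.

Lemma closed_subspaceB x y : W x -> W y -> W (x - y).
Proof.
move=> Wx Wy; apply: closed_subspaceD => //.
by rewrite -scaleN1r; exact: closed_subspace_scale.
Qed.

Let d := inf [set hnorm (f - w) | w in W].

Let has_inf_d : has_inf [set hnorm (f - w) | w in W].
Proof.
split; last by exists 0 => _ [w _ <-]; exact: hnorm_ge0.
by exists (hnorm (f - 0)); exists 0 => //; case: Wsub.
Qed.

Let d_le w : W w -> d <= hnorm (f - w).
Proof. by move=> Ww; apply: ge_inf; [case: has_inf_d|exists w]. Qed.

Let d_ge0 : 0 <= d.
Proof.
apply: lb_le_inf; first by case: has_inf_d.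
by move=> _ [w _ <-]; exact: hnorm_ge0.
Qed.

(* Parallelogram law, applied to f - x and f - y. *)
Let near_minimizers (e : R) x y : W x -> W y -> 0 <= e <= 1 ->
  hnorm (f - x) <= d + e -> hnorm (f - y) <= d + e ->
  hnorm (x - y) ^+ 2 <= (8 * d + 4) * e.
Proof.
move=> Wx Wy /andP[e0 e1] fx fy.
(* The midpoint of [x] and [y] lies in [W], hence at distance at least [d] from [f]. *)
have mid : 2 * d <= hnorm ((f - x) + (f - y)).
  have -> : (f - x) + (f - y) =
      scalar_of k 2 *: (f - scalar_of k 2^-1 *: (x + y)).
    rewrite scalerBr scalerA -scalar_ofM divff// scalar_of1 scale1r.
    have -> : 2 = 1 + 1 :> R by ring.
    rewrite scalar_ofD scalar_of1 scalerDl scale1r opprD.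
    by rewrite addrACA.
  rewrite hnorm_scalar_of// ler_pM2l//; apply: d_le.
  by apply: closed_subspace_scale; exact: closed_subspaceD.
have sq (a b : R) : 0 <= a -> a <= b -> a ^+ 2 <= b ^+ 2.
  by move=> a0 ab; rewrite ler_sqr ?nnegrE// (le_trans a0).
have := sq _ _ _ mid; rewrite (hnorm_sqrD (f - x)).
move=> /(_ (mulr_ge0 (ler0n _ 2) d_ge0)).
have := sq _ _ (hnorm_ge0 _) fx; have := sq _ _ (hnorm_ge0 _) fy.
have -> : x - y = (f - y) - (f - x).
  by rewrite opprB [RHS]addrC addrA subrK.
rewrite (hnorm_sqrB (f - y) (f - x)) [ip (f - y) _]ipC scalar_re_conj.
(* What remains is at most 4(d + e)^2 - 4d^2 = 8de + 4e^2, and e^2 <= e gives the factor 8d + 4. *)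
have : 0 <= d * e by rewrite mulr_ge0.
have : e * e <= e by rewrite ler_piMr.
nra.
Qed.

(** A minimizing sequence for the distance [d] is Cauchy by [near_minimizers]; its limit attains
    [d], and a first-order variation at the minimizer gives orthogonality. *)
Lemma orth_decomposition : exists p, W p /\ orth_compl ip W (f - p).
Proof.
have ex_u n : exists w, W w /\ hnorm (f - w) <= d + n.+1%:R^-1.
  have := @inf_adherent _ _ n.+1%:R^-1 _ has_inf_d.
  rewrite invr_gt0 ltr0Sn => /(_ isT) [_ [w Ww <-] fw].
  by exists w; split=> //; exact: ltW.
have [u /all_and2[Wu fu]] := choice ex_u.
have cu : cauchy (u n @[n --> \oo]).
  apply: cauchy_exP => e e0.
  have := ge0_scalar_reK (ltW e0); move: (scalar_re e) => r er.
  have r0 : 0 < r by rewrite -(lt_scalar_of k) scalar_of0 er.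
  have c0 : 0 < 8 * d + 4 by have := d_ge0; lra.
  (* Once 1/(N + 1) is below this threshold, [near_minimizers] puts all later terms within [r] of
     [u N]. *)
  have rc0 : 0 < r ^+ 2 / (8 * d + 4) by rewrite divr_gt0// exprn_gt0.
  have [N _ /(_ N (leqnn N)) /= HN] := near_infty_natSinv_lt (PosNum rc0).
  exists (u N); exists N => // m /= Nm.
  rewrite -ball_normE /ball_ /= -er -scalar_of_hnorm lt_scalar_of.
  rewrite -(@ltr_pXn2r _ 2)// ?nnegrE ?hnorm_ge0 ?(ltW r0)//.
  apply: (@le_lt_trans _ _ ((8 * d + 4) * N.+1%:R^-1)).
    apply: near_minimizers => //.
      by rewrite invr_ge0 ler0n invf_le1 ?ltr0Sn// ler1n.
    apply: (le_trans (fu m)); rewrite lerD2l lef_pV2 ?posrE ?ltr0Sn//.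
    by rewrite ler_nat ltnS.
  by rewrite -ltr_pdivlMl// mulrC.
have /cvg_ex[p up] : cvg (u n @[n --> \oo]) by exact: cauchy_cvg.
have dist_p (e : R) : 0 < e -> \forall n \near \oo, hnorm (p - u n) < e.
  move=> e0; have e0' : 0 < scalar_of k e.
    by rewrite -(scalar_of0 R k) lt_scalar_of.
  move/cvgrPdist_lt : up => /(_ _ e0'); apply: filterS => n.
  by rewrite -scalar_of_hnorm lt_scalar_of.
have Wp : W p.
  case: Wsub => _ _ Wcl; apply: (closed_subspace_cvg Wcl Wu) => e e0.
  by have [N _ /(_ N (leqnn N)) HN] := dist_p _ e0; exists N.
have fp : hnorm (f - p) <= d.
  suff key (e : R) : 0 < e -> hnorm (f - p) <= e + d by apply/ler_addgt0Pl.
  move=> e0; have e20 : 0 < e / 2 by rewrite divr_gt0.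
  near \oo => n.
  have -> : f - p = (f - u n) - (p - u n) by rewrite opprB addrA subrK.
  apply: (le_trans (ler_hnormD _ _)); rewrite hnormN.
  have : hnorm (p - u n) < e / 2 by near: n; exact: dist_p.
  have n_e : n.+1%:R^-1 < e / 2.
    by near: n; exact: (near_infty_natSinv_lt (PosNum e20)).
  move=> p_e.
  have := lerD (le_trans (fu n) (lerD (lexx d) (ltW n_e))) (ltW p_e).
  by move/le_trans; apply; rewrite -addrA -splitr addrC.
exists p; split=> // y Wy; apply: ip_eq0 => a.
have Way : W (a *: y) by exact: closed_subspace_scale.
move: (a *: y) Way => w Ww.
suff key (e : R) : 0 < e -> scalar_re (ip (f - p) w) <= e.
  by apply/ler_addgt0Pl => e e0; rewrite addr0; exact: key.
move=> e0.
have w1 : 0 < hnorm w ^+ 2 + 1 by rewrite ltr_wpDl ?sqr_ge0.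
(* Moving [p] by [t] times [w] stays in [W], so the distance to [f] cannot drop below [d]. Expanding
   the square and dividing by [t] bounds twice the real part by t |w|^2 <= e. *)
pose t := e / (hnorm w ^+ 2 + 1).
have t0 : 0 < t by rewrite divr_gt0.
have : d ^+ 2 <= hnorm (f - p - scalar_of k t *: w) ^+ 2.
  rewrite ler_sqr ?nnegrE ?hnorm_ge0//.
  rewrite -addrA -opprD; apply: d_le.
  by apply: closed_subspaceD => //; exact: closed_subspace_scale.
rewrite hnorm_sqrB ipZr scalar_conj_of scalar_reZ hnorm_scalar_of ?(ltW t0)//.
have : hnorm (f - p) ^+ 2 <= d ^+ 2 by rewrite ler_sqr ?nnegrE ?hnorm_ge0.
set z := scalar_re _ => fpd dw.
have : t * (2 * z) <= t * (t * hnorm w ^+ 2) by nra.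
rewrite ler_pM2l// => zt.
have : t * hnorm w ^+ 2 <= e.
  by rewrite /t mulrAC ler_pdivrMr// ler_wpM2l ?(ltW e0)// lerDl.
lra.
Unshelve. all: by end_near. Qed.

Lemma orth_projP :
  W (orth_proj ip W f) /\ orth_compl ip W (f - orth_proj ip W f).
Proof.
have [p Pp] := orth_decomposition.
apply: (@xgetPex _ 0 [set p | W p /\ orth_compl ip W (f - p)]).
by exists p.
Qed.

(** The difference of two candidates lies in [W] and is also a difference of vectors orthogonal to
    [W], so it is orthogonal to itself. *)
Lemma orth_proj_unique p :
  W p -> orth_compl ip W (f - p) -> orth_proj ip W f = p.
Proof.
have [] := orth_projP; set q := orth_proj _ _ _ => Wq fq Wp fp.
have Wqp : W (q - p) by exact: closed_subspaceB.
apply/eqP; rewrite -subr_eq0; apply/eqP/hnorm_eq0/eqP.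
rewrite -sqrf_eq0 -(scalar_ofK k (_ ^+ 2)) -ipxx.
have qpE : q - p = (f - p) - (f - q) by rewrite opprB [RHS]addrC addrA subrK.
rewrite {1}qpE ipDl ipNl fp// fq// subrr -(scalar_of0 R k) scalar_ofK//.
Qed.

Lemma hnorm_sqr_orth_proj : hnorm f ^+ 2 =
  hnorm (orth_proj ip W f) ^+ 2 + hnorm (f - orth_proj ip W f) ^+ 2.
Proof.
have [WP fP] := orth_projP; rewrite -hnorm_pythagoras ?subrKC//.
exact/ip_eq0C/fP.
Qed.

End Projection.

Lemma orth_proj_id W f : closed_subspace W -> W f -> orth_proj ip W f = f.
Proof.
move=> Wsub Wf; apply: orth_proj_unique => //.
by rewrite subrr => y _; exact: ip0l.
Qed.

Lemma orth_proj_orth_compl W f : closed_subspace W ->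
  orth_proj ip (orth_compl ip W) f = f - orth_proj ip W f.
Proof.
move=> Wsub; have [WP fP] := orth_projP f Wsub.
apply: orth_proj_unique => //; first exact: closed_orth_compl.
by rewrite subKr => y Wy; exact/ip_eq0C/Wy.
Qed.

Lemma orth_projL W a f g : closed_subspace W ->
  orth_proj ip W (a *: f + g) = a *: orth_proj ip W f + orth_proj ip W g.
Proof.
move=> Wsub; have [WPf fPf] := orth_projP f Wsub.
have [WPg gPg] := orth_projP g Wsub.
apply: orth_proj_unique => //; first by case: Wsub => _ + _; apply.
by rewrite opprD addrACA -scalerBr; case: (closed_orth_compl W) => _ + _; apply.
Qed.

End InnerProduct.

(** * Finite spans and positive definite forms *)

Section FiniteSpan.
Variables (K : numFieldType) (V : normedModType K).
Implicit Types (x y : V) (s : seq V).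

(** The recursion adds one generator at a time, which is the induction used by both main lemmas of
    the section. *)
Fixpoint spanned s : set V :=
  if s is e :: s' then [set x | exists a y, spanned s' y /\ x = a *: e + y]
  else [set 0].

Lemma spannedL s a x y : spanned s x -> spanned s y -> spanned s (a *: x + y).
Proof.
elim: s x y => /= [x y -> ->|e s IH x y [b [z [sz ->]]] [c [t [st ->]]]].
  by rewrite scaler0 addr0.
exists (a * b + c), (a *: z + t); split; first exact: IH.
by rewrite scalerDr scalerDl scalerA addrACA.
Qed.

Lemma spannedW s e x : spanned s x -> spanned (e :: s) x.
Proof. by move=> sx /=; exists 0, x; rewrite scale0r add0r. Qed.

Lemma spanned_sum n (e : 'I_n -> V) (c : 'I_n -> K) :
  spanned (map e (enum 'I_n)) (\sum_i c i *: e i).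
Proof.
rewrite -big_enum; elim: (enum _) => /= [|i l IH]; first by rewrite big_nil.
by rewrite big_cons; exists (c i), (\sum_(j <- l) c j *: e j).
Qed.

(* Adding a vector to the span enlarges the common part by at most one
   dimension, which a single further subspace kills. *)
Lemma finite_trivial_bigcap (I : choiceType) (W : I -> set V) s :
  (forall i, W i 0) ->
  (forall i a x y, W i x -> W i y -> W i (a *: x + y)) ->
  (forall x, (forall i, W i x) -> x = 0) ->
  exists J : seq I, forall x,
    spanned s x -> (forall i, i \in J -> W i x) -> x = 0.
Proof.
move=> W0 WL Wcap; elim: s => [|e s [J HJ]]; first by exists [::].
(* Either [J] still suffices after adding [e], or some nonzero [w] survives and an index [i] with
   [w] outside [W i] is added. *)
have [[w [sw Jw w0]]|noW] := pselect (exists w,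
    [/\ spanned (e :: s) w, (forall i, i \in J -> W i w) & w != 0]); last first.
  exists J => x sx Jx; apply: contrapT => /eqP x0.
  by apply: noW; exists x.
have [i Wi] : exists i, ~ W i w.
  apply: contrapT => noi; move/eqP: w0; apply; apply: Wcap => i.
  by apply: contrapT => Wi; apply: noi; exists i.
exists (i :: J) => x sx Jx.
have {}Jx' j : j \in J -> W j x by move=> jJ; apply: Jx; rewrite inE jJ orbT.
have {Jx} ix : W i x by apply: Jx; rewrite inE eqxx.
case: sw => a [y [sy wE]]; case: sx => b [z [sz xE]].
have a0 : a != 0.
  apply/eqP => a0; move/eqP: w0; apply; apply: HJ => //.
  by rewrite wE a0 scale0r add0r.
(* Subtracting this multiple of [w] cancels [e], so the difference lies in the span of [s] and [HJ]
   kills it. A nonzero multiple would then put [w] in [W i]. *)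
have xw : x = (b / a) *: w.
  apply/eqP; rewrite -subr_eq0 addrC -scaleNr; apply/eqP/HJ => [|j jJ].
    rewrite xE wE scalerDr scalerA mulNr divfK// scaleNr addrACA addNr add0r.
    exact: spannedL.
  by apply: WL; [exact: Jw|exact: Jx'].
have [ba0|ba0] := eqVneq (b / a) 0; first by rewrite xw ba0 scale0r.
case: Wi; rewrite -[w]addr0 -[w]scale1r -(mulVf ba0) -scalerA -xw.
by apply: WL.
Qed.

(** [K] carries no conjugation here: conjugate symmetry of [q] is expressed by [q_eq0C], and scaling
    of the second argument by [qZ] on the diagonal. *)
Variable q : V -> V -> K.
Hypothesis qL : forall a x y z, q (a *: x + y) z = a * q x z + q y z.
Hypothesis qDr : forall x y z, q z (x + y) = q z x + q z y.
Hypothesis qZ : forall a x, q (a *: x) (a *: x) = `|a| ^+ 2 * q x x.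
Hypothesis q_eq0C : forall x y, q x y = 0 -> q y x = 0.
Hypothesis q_gt0 : forall x, x != 0 -> 0 < q x x.

(* Gram-Schmidt orthogonalisation with respect to q. *)
Lemma spanned_bound_proj s :
  (exists2 C, 0 <= C & forall x, spanned s x -> `|x| ^+ 2 <= C * q x x) /\
  (forall f, exists p, spanned s p /\ forall x, spanned s x -> q (f - p) x = 0).
Proof.
have q0l z : q 0 z = 0.
  have := qL 1 0 0 z; rewrite scaler0 addr0 mul1r => /eqP.
  by rewrite addrC -subr_eq subrr eq_sym => /eqP.
have qZl b x z : q (b *: x) z = b * q x z.
  by rewrite -[b *: x]addr0 qL q0l addr0.
have q0r z : q z 0 = 0 by apply/q_eq0C/q0l.
have q_ge0 x : 0 <= q x x.
  by have [->|/q_gt0/ltW//] := eqVneq x 0; rewrite q0l.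
elim: s => [|e s [[C C0 HC] proj]].
  split; first by exists 0 => // x ->; rewrite normr0 expr0n mul0r.
  by move=> f; exists 0; split=> // x ->; rewrite q0r.
have [p [sp ep]] := proj e.
(* [e'] is the part of [e] that is [q]-orthogonal to the span of [s]. *)
move e'E : (e - p) ep => e' ep.
have split_x x : spanned (e :: s) x ->
    exists a y, spanned s y /\ x = a *: e' + y.
  move=> [a [y [sy ->]]]; exists a, (a *: p + y); split; first exact: spannedL.
  by rewrite addrA -scalerDr -e'E subrK.
have [e'0|e'0] := eqVneq e' 0.
  have sub x : spanned (e :: s) x -> spanned s x.
    by move=> /split_x [a [y [sy ->]]]; rewrite e'0 scaler0 add0r.
  split; first by exists C => // x /sub; exact: HC.
  move=> f; have [r [sr fr]] := proj f; exists r; split; first exact: spannedW.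
  by move=> x /sub; exact: fr.
have qe' := q_gt0 e'0.
split.
  (* By orthogonality [q] splits as |a|^2 q(e', e') + q(y, y), while |a e' + y|^2 <= 2|a|^2 |e'|^2 +
     2|y|^2. Each summand of the constant absorbs one term; the cross products are nonnegative. *)
  exists (2 * `|e'| ^+ 2 / q e' e' + 2 * C) => [|x /split_x [a [y [sy ->]]]].
    by rewrite addr_ge0 ?mulr_ge0 ?invr_ge0 ?exprn_ge0 ?(ltW qe').
  have -> : q (a *: e' + y) (a *: e' + y) = `|a| ^+ 2 * q e' e' + q y y.
    rewrite qL !qDr (ep y sy) addr0.
    rewrite [q y (a *: e')]q_eq0C ?add0r ?qZl ?(ep y sy) ?mulr0//.
    by rewrite -qZ qZl.
  have n_le : `|a *: e' + y| ^+ 2 <=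
      2 * (`|a| ^+ 2 * `|e'| ^+ 2) + 2 * `|y| ^+ 2.
    have : `|a *: e' + y| ^+ 2 <= (`|a| * `|e'| + `|y|) ^+ 2.
      rewrite ler_sqr ?nnegrE ?addr_ge0 ?mulr_ge0//.
      by rewrite -normrZ ler_normD.
    move=> /le_trans; apply; rewrite -exprMn -subr_ge0.
    set u := `|a| * _; set v := `|y|.
    have -> : 2 * u ^+ 2 + 2 * v ^+ 2 - (u + v) ^+ 2 = (u - v) ^+ 2 by ring.
    by rewrite real_exprn_even_ge0// realB ?realM ?normr_real.
  apply: (le_trans n_le).
  have Cy := HC _ sy; have := q_ge0 y; have := exprn_ge0 2 (normr_ge0 a).
  move: (`|a| ^+ 2) (`|e'| ^+ 2) (exprn_ge0 2 (normr_ge0 e')) => u w w0 u0 y0.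
  have -> : (2 * w / q e' e' + 2 * C) * (u * q e' e' + q y y) =
      2 * (u * w) + 2 * (C * q y y) +
      2 * (w / q e' e' * q y y + C * (u * q e' e')).
    by field; rewrite gt_eqF.
  rewrite -[leLHS]addr0 lerD ?lerD2l ?ler_wpM2l//.
  by rewrite mulr_ge0// addr_ge0// !mulr_ge0// ?invr_ge0 ltW.
move=> f; have [r [sr fr]] := proj f.
exists ((q (f - r) e' / q e' e') *: e' + r); split.
  exists (q (f - r) e' / q e' e'), ((- (q (f - r) e' / q e' e')) *: p + r).
  split; first exact: spannedL.
  by rewrite addrA scaleNr -scalerBr e'E.
move=> x /split_x [a [y [sy ->]]]; set b := _ / _.
have qZ0 z t : q z t = 0 -> q z (a *: t) = 0.
  by move=> zt; apply: q_eq0C; rewrite qZl (q_eq0C zt) mulr0.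
have -> : f - (b *: e' + r) = (- b) *: e' + (f - r).
  by rewrite opprD scaleNr addrCA.
rewrite qDr qZ0 ?add0r; first by rewrite qL (ep y sy) fr// mulr0 addr0.
by rewrite qL mulNr /b divfK ?gt_eqF// addNr.
Qed.

End FiniteSpan.

(** * Frame sums and their bounds *)

Section FrameSums.
Variables (R : realType) (k : scalar_kind).
Variable H : completeNormedModType (scalar_field R k).
Variable ip : {dot H for @scalar_conj R k}.
Hypothesis ipE : norm_from_ip ip.
Variables (I : choiceType) (v : I -> R).
Implicit Types (W : I -> set H) (f g : H).

Definition frame_sum W f : \bar R :=
  (\esum_(i in [set: I]) (v i ^+ 2 * hnorm (orth_proj ip (W i) f) ^+ 2)%:E)%E.

Lemma frame_sum_ge0 W f : (0 <= frame_sum W f)%E.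
Proof. by apply: esum_ge0 => i _; rewrite lee_fin mulr_ge0 ?sqr_ge0. Qed.

Lemma total_weight_ge0 : (0 <= total_weight v)%E.
Proof. by apply: esum_ge0 => i _; rewrite lee_fin sqr_ge0. Qed.

(** The factor passes through the supremum of the finite partial sums, so an infinite total weight
    is covered. *)
Lemma esum_weight_mulr (c : R) : 0 <= c ->
  (\esum_(i in [set: I]) (v i ^+ 2 * c)%:E = c%:E * total_weight v)%E.
Proof.
move=> c0; rewrite /total_weight /esum -ereal_supZl//; last first.
  by apply/set0P; exists 0%E, set0; [exact: fsets_set0|rewrite fsbig_set0].
congr ereal_sup; rewrite image_comp; apply: eq_imagel => A [finA _] /=.
rewrite ge0_mule_fsumr; last by move=> i; rewrite lee_fin sqr_ge0.
by apply: eq_fsbigr => i _; rewrite -EFinM mulrC.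
Qed.

Lemma frame_sum_bigcap W f : (forall i, closed_subspace (W i)) ->
  (\bigcap_i W i) f -> frame_sum W f = ((hnorm f ^+ 2)%:E * total_weight v)%E.
Proof.
move=> Wsub Wf; rewrite -esum_weight_mulr ?sqr_ge0//.
by apply: eq_esum => i _; rewrite orth_proj_id//; exact: Wf.
Qed.

Lemma frame_sumD W f : (forall i, closed_subspace (W i)) ->
  (frame_sum W f + frame_sum (fun i => orth_compl ip (W i)) f =
   (hnorm f ^+ 2)%:E * total_weight v)%E.
Proof.
move=> Wsub; rewrite -esum_weight_mulr ?sqr_ge0// -esumD; first last.
- by move=> i _; rewrite lee_fin mulr_ge0 ?sqr_ge0.
- by move=> i _; rewrite lee_fin mulr_ge0 ?sqr_ge0.
apply: eq_esum => i _; rewrite -EFinD -mulrDr orth_proj_orth_compl//.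
by rewrite -hnorm_sqr_orth_proj.
Qed.

Lemma frame_sumE W (t : R) :
  (forall i, closed_subspace (W i)) -> total_weight v = t%:E ->
  exists s : H -> R, forall f, frame_sum W f = (s f)%:E /\
    frame_sum (fun i => orth_compl ip (W i)) f = (t * hnorm f ^+ 2 - s f)%:E.
Proof.
move=> Wsub vt; exists (fun f => fine (frame_sum W f)) => f.
have := frame_sumD f Wsub; rewrite vt -EFinM.
have := frame_sum_ge0 W f.
have := frame_sum_ge0 (fun i => orth_compl ip (W i)) f.
(* Two nonnegative terms with a real sum are both finite. *)
case: (frame_sum W f) => [a| |]; case: (frame_sum _ f) => [b| |] //= _ _.
move=> [abt]; split=> //; congr EFin; rewrite -[LHS](addKr a) abt; ring.
Qed.

Lemma le_frame_sum_orth_compl W f (J : seq I) : uniq J ->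
  (forall i, closed_subspace (W i)) ->
  ((\sum_(i <- J) v i ^+ 2 * hnorm (f - orth_proj ip (W i) f) ^+ 2)%:E <=
   frame_sum (fun i => orth_compl ip (W i)) f)%E.
Proof.
move=> uJ Wsub; apply: esum_ge; exists [set` J]; first by split.
rewrite -fsbig_seq// -sumEFin; apply: lee_sum => i _.
by rewrite orth_proj_orth_compl.
Qed.

(** A nonzero vector yields [A <= B] from the two inequalities, on division by its squared norm. *)
Lemma fusion_frame_real W (A B : R) :
  (forall i, closed_subspace (W i)) -> (forall i, 0 < v i) -> 0 < A ->
  (exists f : H, f != 0) ->
  (forall f, ((A * hnorm f ^+ 2)%:E <= frame_sum W f)%E /\
             (frame_sum W f <= (B * hnorm f ^+ 2)%:E)%E) ->
  fusion_frame ip W v A%:E B%:E.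
Proof.
move=> Wsub v0 A0 [f f0] AB; split=> //; split; rewrite ?lte_fin ?ltry//.
have [Af fB] := AB f; have := le_trans Af fB; rewrite !lee_fin ler_pM2r//.
rewrite exprn_gt0// lt0r hnorm_ge0 andbT.
by apply: contra_neq f0; exact: hnorm_eq0.
Qed.

(** In the zero space all positive bounds are valid, so no lower bound is largest: the pair [B + 1],
    [B + 1] would force B + 1 <= A <= B. *)
Lemma optimal_fusion_frame_nontrivial W (A B : R) :
  optimal_fusion_frame ip W v A%:E B%:E -> exists f : H, f != 0.
Proof.
move=> [[Wsub v0 [A0 AB _] _] opt]; apply: contrapT => triv.
have H0 (f : H) : f = 0.
  by apply: contrapT => /eqP f0; apply: triv; exists f.
have /opt[+ _] : fusion_frame ip W v (B + 1)%:E (B + 1)%:E.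
  move: A0 AB; rewrite lte_fin lee_fin => A0 AB.
  split=> //; first by rewrite lte_fin ltry; split=> //; lra.
  move=> f; rewrite (H0 f) hnorm0 expr0n /= mule0; split.
    exact: frame_sum_ge0.
  rewrite esum1// => i _.
  by rewrite (H0 (orth_proj _ _ _)) hnorm0 expr0n /= mulr0.
move: AB; rewrite !lee_fin; lra.
Qed.

(** This gives the complements the lower frame bound 1/C; writing [C] on the right also allows an
    infinite frame sum. *)
Lemma finite_dimensional_residual_bound W :
  (forall i, closed_subspace (W i)) -> (forall i, 0 < v i) ->
  finite_dimensional H -> \bigcap_i W i = [set 0] ->
  exists2 C : R, 0 < C & forall f,
    ((hnorm f ^+ 2)%:E <=
     C%:E * frame_sum (fun i => orth_compl ip (W i)) f)%E.
Proof.
move=> Wsub v0 [n [e He]] Wcap.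
pose s := map e (enum 'I_n).
have sH (f : H) : spanned s f by have [c ->] := He f; exact: spanned_sum.
have [J HJ] : exists J : seq I, forall f : H,
    spanned s f -> (forall i, i \in J -> W i f) -> f = 0.
  apply: finite_trivial_bigcap => [i|i|x Wx]; [by case: (Wsub i)..|].
  suff : (\bigcap_i W i) x by rewrite Wcap.
  by move=> i _; exact: Wx.
pose D i f := f - orth_proj ip (W i) f.
have DL i a x y : D i (a *: x + y) = a *: D i x + D i y.
  by rewrite /D orth_projL// scalerBr opprD addrACA.
pose w i := scalar_of k (v i ^+ 2).
(* [undup] counts each index once, as the comparison with the full frame sum requires. *)
pose q f g := \sum_(i <- undup J) w i * ip (D i f) (D i g).
have qE f : q f f = scalar_of k
    (\sum_(i <- undup J) v i ^+ 2 * hnorm (D i f) ^+ 2).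
  rewrite (big_morph (scalar_of k) (@scalar_ofD R k) (scalar_of0 R k)).
  by apply: eq_bigr => i _; rewrite scalar_ofM ipxx.
have qL a x y z : q (a *: x + y) z = a * q x z + q y z.
  rewrite /q mulr_sumr -big_split; apply: eq_bigr => i _ /=.
  by rewrite DL ipDl ipZl mulrDr mulrCA.
have qC x y : q y x = scalar_conj (q x y).
  rewrite /q.
  rewrite (big_morph (@scalar_conj R k) (@scalar_conjD R k) (scalar_conj0 R k)).
  by apply: eq_bigr => i _; rewrite scalar_conjM scalar_conj_of -ipC.
have qDr x y z : q z (x + y) = q z x + q z y.
  by rewrite qC -[x]scale1r qL scalar_conjD scale1r mul1r -!qC.
have q00 z : q 0 z = 0.
  rewrite /q big1// => i _; rewrite /D orth_proj_id//; last by case: (Wsub i).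
  by rewrite subrr ip0l mulr0.
have qZ a x : q (a *: x) (a *: x) = `|a| ^+ 2 * q x x.
  have qZl y : q (a *: x) y = a * q x y by rewrite -[a *: x]addr0 qL q00 addr0.
  rewrite qZl qC qZl scalar_conjM mulrA mul_scalar_conj.
  by rewrite -qC.
have q_eq0C x y : q x y = 0 -> q y x = 0.
  by rewrite (qC x y) => ->; exact: scalar_conj0.
(* If [q x x] vanishes, so does each residual [D i x] with [i] in [J]; then [x] lies in all these
   [W i] and [HJ] applies. *)
have q_gt0 x : x != 0 -> 0 < q x x.
  move=> x0; rewrite lt0r; apply/andP; split; last first.
    rewrite qE -(scalar_of0 R k) le_scalar_of; apply: sumr_ge0 => i _.
    by rewrite mulr_ge0 ?sqr_ge0.
  apply: contra_neq x0 => qx; apply: HJ => // i iJ.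
  have : \sum_(i <- undup J) v i ^+ 2 * hnorm (D i x) ^+ 2 = 0.
    by rewrite -[LHS](scalar_ofK k) -qE qx -(scalar_of0 R k) scalar_ofK.
  move/eqP; rewrite psumr_eq0 => [/allP /(_ i)|j _]; last first.
    by rewrite mulr_ge0 ?sqr_ge0.
  rewrite mem_undup => /(_ iJ); rewrite mulf_eq0 !sqrf_eq0 gt_eqF//=.
  move=> /eqP/hnorm_eq0/eqP; rewrite subr_eq0 => /eqP ->.
  by have [] := orth_projP ipE x (Wsub i).
have [[C C0 HC] _] := spanned_bound_proj qL qDr qZ q_eq0C q_gt0 s.
have := ge0_scalar_reK C0; move: (scalar_re C) => c CE.
have c0 : 0 <= c by rewrite -(le_scalar_of k) CE scalar_of0.
(* The constant [c] may be 0, hence the added 1. *)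
exists (c + 1); first by rewrite ltr_wpDl.
move=> f.
have J_ge0 : 0 <= \sum_(i <- undup J) v i ^+ 2 * hnorm (D i f) ^+ 2.
  by apply: sumr_ge0 => i _; rewrite mulr_ge0 ?sqr_ge0.
have J_le := le_frame_sum_orth_compl f (undup_uniq J) Wsub.
apply: le_trans (lee_wpmul2l _ J_le); last by rewrite lee_fin addr_ge0.
rewrite -EFinM lee_fin; have := HC f (sH f).
rewrite qE -CE -scalar_ofM -scalar_of_hnorm expr2 -scalar_ofM -expr2.
by rewrite le_scalar_of => /le_trans; apply; rewrite ler_wpM2r// lerDl.
Qed.

End FrameSums.

(* The implication (i) -> (ii) fails in infinite dimension, and (ii) -> (iii)
   fails when the squared weights are not summable: those hypotheses guard
   exactly these two implications. *)
Theorem theorem3p2 (R : realType) (k : scalar_kind)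
  (H : completeNormedModType (scalar_field R k)) (ip : {dot H for @scalar_conj R k})
  (H_hilbert : norm_from_ip ip)
  (I : choiceType) (W : I -> set H) (v : I -> R) (A B : R)
  (frameW : optimal_fusion_frame ip W v A%:E B%:E) :
  let cond_i := \bigcap_i W i = [set 0] in
  let cond_ii := (B%:E < total_weight v)%E in
  let cond_iii :=
    optimal_fusion_frame ip (fun i => orth_compl ip (W i)) v
      (total_weight v - B%:E)%E (total_weight v - A%:E)%E in
  [/\ finite_dimensional H -> (cond_i <-> cond_ii),
      (total_weight v < +oo)%E -> (cond_ii <-> cond_iii),
      cond_ii -> cond_i
    & cond_iii -> cond_ii].
Proof.
move=> cond_i cond_ii cond_iii.
have [f0 f0_neq0] := optimal_fusion_frame_nontrivial frameW.
have hnorm2_gt0 f : f != 0 -> 0 < hnorm f ^+ 2.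
  move=> f_neq0; rewrite exprn_gt0// lt0r hnorm_ge0 andbT.
  by apply: contra_neq f_neq0; exact: hnorm_eq0.
have [[Wsub v0 [A0 AB _] bnd] opt] := frameW.
rewrite lte_fin in A0; rewrite lee_fin in AB.
(* By conversion: [frame_sum] is the middle term of [fusion_frame]. *)
have {}bnd f : ((A * hnorm f ^+ 2)%:E <= frame_sum ip v W f)%E /\
    (frame_sum ip v W f <= (B * hnorm f ^+ 2)%:E)%E := bnd f.
have mkframe := @fusion_frame_real R k H ip I v.
have ii_i : cond_ii -> cond_i.
  rewrite /cond_ii => Bt; apply/seteqP; split => [f Wf|_ -> i _]; last first.
    by case: (Wsub i).
  apply: contrapT => /eqP /hnorm2_gt0 f_gt0.
  have [_] := bnd f.
  rewrite frame_sum_bigcap// [B * _]mulrC (EFinM _ B) lee_pmul2l//.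
  by rewrite leNgt Bt.
have iii_ii : cond_iii -> cond_ii.
  by move=> [[_ _ [+ _ _] _] _]; rewrite sube_gt0.
have ii_iii : (total_weight v < +oo)%E -> cond_ii -> cond_iii.
  rewrite /cond_ii /cond_iii => t_fin.
  have vt : total_weight v = (fine (total_weight v))%:E.
    by rewrite fineK// ge0_fin_numE ?total_weight_ge0.
  move: (fine _) vt => t vt; rewrite vt lte_fin -!EFinB => Bt.
  have [s sE] := frame_sumE H_hilbert Wsub vt.
  have s_bnd f : A * hnorm f ^+ 2 <= s f <= B * hnorm f ^+ 2.
    by have := bnd f; rewrite (sE f).1 !lee_fin => -[-> ->].
  split.
    apply: mkframe => //.
    - by move=> i; exact: closed_orth_compl.
    - lra.
    - by exists f0.
    move=> f; rewrite (sE f).2 !lee_fin; have /andP[] := s_bnd f; lra.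
  (* For optimality, bounds [a'], [b'] of the complements are turned back into bounds [t - b'],
     [t - a'] for [W], where [opt] applies. *)
  move=> A' B' [_ _ [A'0 A'B' B'oo] bnd'].
  have A'_fin : A' \is a fin_num.
    by rewrite ge0_fin_numE ?ltW//; exact: le_lt_trans B'oo.
  have B'_fin : B' \is a fin_num.
    by rewrite ge0_fin_numE// (le_trans (ltW A'0)).
  move: A' B' A'_fin B'_fin A'0 A'B' B'oo bnd' => [a'| |] [b'| |] // _ _.
  rewrite lte_fin lee_fin => a'0 a'b' _ bnd'.
  have s_bnd' f :
      a' * hnorm f ^+ 2 <= t * hnorm f ^+ 2 - s f <= b' * hnorm f ^+ 2.
    have : ((a' * hnorm f ^+ 2)%:E <=
        frame_sum ip v (fun i => orth_compl ip (W i)) f)%E /\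
      (frame_sum ip v (fun i => orth_compl ip (W i)) f <=
        (b' * hnorm f ^+ 2)%:E)%E := bnd' f.
    by rewrite (sE f).2 !lee_fin => -[-> ->].
  split; rewrite lee_fin.
    suff /opt[_] : fusion_frame ip W v A%:E (t - a')%:E by rewrite lee_fin; lra.
    apply: mkframe => //; first by exists f0.
    move=> f; rewrite (sE f).1 !lee_fin.
    by have /andP[-> _] := s_bnd f; have /andP[] := s_bnd' f; split=> //; lra.
  (* A lower frame bound must be positive; if [t - b'] is not, then t - A <= b' already follows from
     0 < A. *)
  have [tb'|tb'] := lerP (t - b') 0; first by lra.
  suff /opt[+ _] : fusion_frame ip W v (t - b')%:E B%:E by rewrite lee_fin; lra.
  apply: mkframe => //; first by exists f0.
  move=> f; rewrite (sE f).1 !lee_fin.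
  by have /andP[_ ->] := s_bnd f; have /andP[] := s_bnd' f; split=> //; lra.
split=> // [fdH|t_fin]; last by split; [exact: ii_iii|exact: iii_ii].
(* By contradiction: t <= B makes the total weight finite, so frame sums can be subtracted. *)
split=> // Wcap; rewrite /cond_ii ltNge; apply/negP => tB.
have vt : total_weight v = (fine (total_weight v))%:E.
  rewrite fineK// ge0_fin_numE ?total_weight_ge0//.
  by apply: (le_lt_trans tB); exact: ltry.
move: (fine _) vt tB => t vt; rewrite vt lee_fin => tB.
have [s sE] := frame_sumE H_hilbert Wsub vt.
have [C C0 HC] := finite_dimensional_residual_bound H_hilbert Wsub v0 fdH Wcap.
(* The complements contribute at least |f|^2 / C, so t - 1/C is an upper bound for [W]. Optimality
   then gives B <= t - 1/C < t <= B. *)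
have : fusion_frame ip W v A%:E (t - C^-1)%:E.
  apply: mkframe => //; first by exists f0.
  move=> f; split; first by have [] := bnd f.
  rewrite (sE f).1 lee_fin.
  have := HC f; rewrite (sE f).2 -EFinM lee_fin -ler_pdivrMl//; lra.
move=> /opt[_]; rewrite lee_fin.
have : 0 < C^-1 by rewrite invr_gt0.
lra.
Qed.
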